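(* Let $d\ge 1$ be an integer, $L,\Delta,\delta>0$, $\mathbf{x}_0\in\mathbb{R}^d$, and $0<\epsilon<L$. There is a deterministic algorithm using only function values which returns a $(\delta,\epsilon)$-Goldstein stationary point of every $f\in\mathcal{F}_d(L,\Delta;\mathbf{x}_0)$ within $$1+\left(\frac{2\Delta}{\delta\epsilon}+1\right)\left(1+\frac{4L}{\epsilon}\right)^d$$ total calls. If instead $\epsilon\ge L$, then for every $f\in\mathcal{F}_d(L,\Delta;\mathbf{x}_0)$ the initial point $\mathbf{x}_0$ is already $(\delta,\epsilon)$-Goldstein stationary, so the prescribed initial call (followed by returning $\mathbf{x}_0$) suffices.
   Context: All norms are Euclidean; $\mathbb{B}_r(\mathbf{x})$ is the closed ball of radius $r$ about $\mathbf{x}$. Goldstein stationarity. For locally Lipschitz $f:\mathbb{R}^d\to\mathbb{R}$, $f^\circ(\mathbf{x};\mathbf{v})=\limsup_{\mathbf{y}\to\mathbf{x},\,t\downarrow 0}\frac{f(\mathbf{y}+t\mathbf{v})-f(\mathbf{y})}{t}$, the Clarke subdifferential is $\partial f(\mathbf{x})=\{\mathbf{g}:\langle\mathbf{g},\mathbf{v}\rangle\le f^\circ(\mathbf{x};\mathbf{v})\ \forall\mathbf{v}\in\mathbb{R}^d\}$, and the Goldstein subdifferential is $\partial_\delta f(\mathbf{x})=\mathrm{conv}\big(\bigcup_{\mathbf{y}\in\mathbb{B}_\delta(\mathbf{x})}\partial f(\mathbf{y})\big)$. A point $\mathbf{x}$ is $(\delta,\epsilon)$-Goldstein stationary if $\inf_{\mathbf{g}\in\partial_\delta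 f(\mathbf{x})}\|\mathbf{g}\|\le\epsilon$. Function class. $\mathcal{F}_d(L,\Delta;\mathbf{x}_0)$ is the set of all $f:\mathbb{R}^d\to\mathbb{R}$ with $|f(\mathbf{x})-f(\mathbf{y})|\le L\|\mathbf{x}-\mathbf{y}\|$ for all $\mathbf{x},\mathbf{y}$, $\inf f>-\infty$, and $f(\mathbf{x}_0)-\inf f\le\Delta$. Model. A call at a point $\mathbf{q}\in\mathbb{R}^d$ returns the exact value $f(\mathbf{q})$. The algorithm receives $d,L,\Delta,\mathbf{x}_0,\delta,\epsilon$; its first call is at $\mathbf{x}_0$; each further action (next query point, or stopping and returning a point of $\mathbb{R}^d$) is a deterministic function of the input and of the query points and values seen so far. Arbitrary finite internal computation with exact real arithmetic and comparisons (including finite preprocessing) is allowed between calls and is not charged. Every call is counted, including the initial one and repeated ones. The same algorithm must work for every $f$ in the class. *)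

(* Defs.v *)
From HB Require Import structures.
From mathcomp Require Import all_boot all_order all_algebra.
From mathcomp Require Import all_classical all_reals all_analysis.

Set Implicit Arguments.
Unset Strict Implicit.
Unset Printing Implicit Defensive.

Import Order.TTheory GRing.Theory Num.Theory.
Import numFieldNormedType.Exports.

Local Open Scope classical_set_scope.
Local Open Scope ring_scope.

(* The norm `|x| that MathComp-Analysis puts on 'rV_d is the sup norm.  The
   topology it generates is the Euclidean one, but norms and balls have to be
   taken with the norm below. *)
Definition dot (R : realType) (d : nat) (u v : 'rV[R]_d) : R :=
  \sum_(i < d) u 0 i * v 0 i.

Definition enorm (R : realType) (d : nat) (u : 'rV[R]_d) : R :=
  Num.sqrt (dot u u).

Definition eball (R : realType) (d : nat) (x : 'rV[R]_d) (r : R) :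
    set 'rV[R]_d :=
  [set y | enorm (y - x) <= r].

Definition clarke_deriv (R : realType) (d : nat) (f : 'rV[R]_d -> R)
    (x v : 'rV[R]_d) : \bar R :=
  limf_esup (fun p : 'rV[R]_d * R => ((f (p.1 + p.2 *: v) - f p.1) / p.2)%:E)
    (filter_prod (nbhs x) 0^'+).

Definition clarke_subdiff (R : realType) (d : nat) (f : 'rV[R]_d -> R)
    (x : 'rV[R]_d) : set 'rV[R]_d :=
  [set g | forall v, ((dot g v)%:E <= clarke_deriv f x v)%E].

Definition conv (R : realType) (d : nat) (S : set 'rV[R]_d) :
    set 'rV[R]_d :=
  smallest (@convex_set R 'rV[R]_d) S.

Definition goldstein_subdiff (R : realType) (d : nat) (delta : R)
    (f : 'rV[R]_d -> R) (x : 'rV[R]_d) : set 'rV[R]_d :=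
  conv (\bigcup_(y in eball x delta) clarke_subdiff f y).

Definition goldstein_stationary (R : realType) (d : nat) (delta eps : R)
    (f : 'rV[R]_d -> R) (x : 'rV[R]_d) : Prop :=
  (ereal_inf [set (enorm g)%:E | g in goldstein_subdiff delta f x] <= eps%:E)%E.

Definition lipschitz_class (R : realType) (d : nat) (L Delta : R)
    (x0 : 'rV[R]_d) : set ('rV[R]_d -> R) :=
  [set f | [/\ forall x y, `|f x - f y| <= L * enorm (x - y),
               has_lbound (range f)
             & f x0 - inf (range f) <= Delta]].

Inductive action (T : Type) : Type := Query of T | Return of T.

(* A history lists, in chronological order, the points queried so far with the
   values returned there. *)
Definition history (R : realType) (d : nat) : Type := seq ('rV[R]_d * R).

Definition strategy (R : realType) (d : nat) : Type :=
  history R d -> action 'rV[R]_d.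

(* [run f s h x n]: resumed after history [h], the strategy [s] facing [f]
   stops and returns [x], the total number of calls, those in [h] included,
   being [n]. *)
Inductive run (R : realType) (d : nat) (f : 'rV[R]_d -> R)
    (s : strategy R d) : history R d -> 'rV[R]_d -> nat -> Prop :=
| run_return h x : s h = Return x -> run f s h x (size h)
| run_query h q x n : s h = Query q -> run f s (rcons h (q, f q)) x n ->
    run f s h x n.

Definition returns (R : realType) (d : nat) (f : 'rV[R]_d -> R)
    (s : strategy R d) (x0 x : 'rV[R]_d) (n : nat) : Prop :=
  run f s [:: (x0, f x0)] x n.

(* Total functions computable by a uniform exact real-arithmetic machine
   (real RAM / Blum-Shub-Smale): real arithmetic and comparisons are basic
   operations, control is given by tests, bounded recursion on naturals and on
   lists, and an unbounded search which is required to terminate.  The only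
   real constants are 0 and 1, so that no information about a particular
   problem instance can be built into such a function. *)
Inductive bss_computable (R : realType) :
    forall A B : Type, (A -> B) -> Prop :=
| bss_id A : @bss_computable R A A (fun a => a)
| bss_comp A B C (g : B -> C) (f : A -> B) :
    bss_computable R g -> bss_computable R f ->
    bss_computable R (fun a => g (f a))
| bss_pair A B C (f : A -> B) (g : A -> C) :
    bss_computable R f -> bss_computable R g ->
    bss_computable R (fun a => (f a, g a))
| bss_fst A B : bss_computable R (fun p : A * B => p.1)
| bss_snd A B : bss_computable R (fun p : A * B => p.2)
| bss_bool A (b : bool) : bss_computable R (fun _ : A => b)
| bss_if A B (p : A -> bool) (f g : A -> B) :
    bss_computable R p -> bss_computable R f -> bss_computable R g ->
    bss_computable R (fun a => if p a then f a else g a)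
| bss_zero A : bss_computable R (fun _ : A => 0%N)
| bss_succ : bss_computable R succn
| bss_nat_rec A B (f : A -> B) (g : A * nat * B -> B) :
    bss_computable R f -> bss_computable R g ->
    bss_computable R
      (fun p : A * nat => iteri p.2 (fun n b => g (p.1, n, b)) (f p.1))
| bss_nil A B : bss_computable R (fun _ : A => [::] : seq B)
| bss_cons A : bss_computable R (fun p : A * seq A => p.1 :: p.2)
| bss_list_rec A B C (f : A -> B) (g : A * C * B -> B) :
    bss_computable R f -> bss_computable R g ->
    bss_computable R
      (fun p : A * seq C => foldr (fun c b => g (p.1, c, b)) (f p.1) p.2)
| bss_search A (p : A * nat -> bool) (p_ex : forall a, exists n, p (a, n)) :
    bss_computable R p -> bss_computable R (fun a => ex_minn (p_ex a))
| bss_real0 A : bss_computable R (fun _ : A => 0 : R)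
| bss_real1 A : bss_computable R (fun _ : A => 1 : R)
| bss_add : bss_computable R (fun p : R * R => p.1 + p.2)
| bss_opp : bss_computable R (fun x : R => - x)
| bss_mul : bss_computable R (fun p : R * R => p.1 * p.2)
| bss_inv : bss_computable R (fun x : R => x^-1)
| bss_le : bss_computable R (fun p : R * R => p.1 <= p.2).

(* The input (d, L, Delta, x0, delta, eps), with x0 given by its coordinates. *)
Definition input (R : realType) : Type := (nat * R * R * seq R * R * R)%type.

(* An algorithm maps the input and the history to the next action; a point is
   given by its coordinates, and the boolean is [true] for a query and [false]
   for stopping and returning the point. *)
Definition algorithm (R : realType) : Type :=
  input R * seq (seq R * R) -> bool * seq R.

Definition coords (R : realType) (d : nat) (x : 'rV[R]_d) : seq R :=
  [seq x 0 i | i <- enum 'I_d].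

Definition point (R : realType) (d : nat) (s : seq R) : 'rV[R]_d :=
  \row_(i < d) s`_i.

Definition strategy_of (R : realType) (A : algorithm R) (d : nat)
    (L Delta : R) (x0 : 'rV[R]_d) (delta eps : R) : strategy R d :=
  fun h =>
    let: (is_query, s) :=
      A ((d, L, Delta, coords x0, delta, eps),
         [seq (coords qv.1, qv.2) | qv <- h]) in
    if is_query then Query (point d s) else Return (point d s).

(* Main.v *)
Require Import Defs.
From mathcomp Require Import all_boot all_order all_algebra.
From mathcomp Require Import all_classical all_reals all_analysis.
From mathcomp Require Import ring lra zify.

(** The search keeps a center [x] and queries [x + delta *: v] for [v] in a fixed
finite net of the unit sphere. A trial point that improves on [f x] by at least
[delta * eps / 2] becomes the new center; when the whole net has failed, [x] is
returned. Two facts make this work.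

Stationarity of the output: if [x] is not stationary, a unit vector [u]
satisfies [dot g u <= - eps] for all [g] in the Goldstein subdifferential
([convex_norm_separation]). The Clarke derivative is the support function of the
Clarke subdifferential ([clarke_subdiff_supported], a finite-dimensional
Hahn-Banach theorem), so it is at most [- eps] in direction [u] all along the
segment from [x] to [x + delta *: u], and a mean value inequality
([clarke_mean_value]) gives [f (x + delta *: u) <= f x - delta * eps]. A net
vector within [eps / (2 * L)] of [u] keeps at least half of this decrease, hence
passes the test.

Number of calls: each move decreases [f] by [delta * eps / 2], so there are at
most [2 * Delta / (delta * eps)] of them, and each center costs at most one pass
over the net. It remains to compute, by exact arithmetic, a net of mesh
[eps / (2 * L)] with at most [(1 + 4 * L / eps) ^+ d] elements. A greedy choice
among the points of a fine grid yields a maximal set of points that are pairwise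
[s] apart, to which the bound [(1 + 2 / s) ^+ d] applies
([size_spread_unit_ball]). The usual proof compares volumes; here a set of [n]
separated points is copied around larger and larger dilations of itself: this gives
[n ^ k] separated points in a ball whose radius grows like [(1 + 2 / s) ^+ k],
and these are counted by integer cells. The separation [s] must be slightly less
than [eps / (2 * L)] to absorb the grid error. The bound that results exceeds
[(1 + 4 * L / eps) ^+ d] by at most one, and the net is in fact one point smaller
than its packing bound, because the origin can be added to it. *)

Set Implicit Arguments.
Unset Strict Implicit.
Unset Printing Implicit Defensive.

Import Order.TTheory GRing.Theory Num.Theory.
Import numFieldNormedType.Exports.

Local Open Scope classical_set_scope.
Local Open Scope ring_scope.

(** * Euclidean geometry *)

Section Euclidean.
Variables (R : realType) (d : nat).
Implicit Types (u v w x y : 'rV[R]_d) (a b c : R).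

Lemma dotC u v : dot u v = dot v u.
Proof. by apply: eq_bigr => i _; rewrite mulrC. Qed.

Lemma dotDl u v w : dot (u + v) w = dot u w + dot v w.
Proof. by rewrite -big_split; apply: eq_bigr => i _; rewrite mxE mulrDl. Qed.

Lemma dotZl a u v : dot (a *: u) v = a * dot u v.
Proof. by rewrite mulr_sumr; apply: eq_bigr => i _; rewrite mxE mulrA. Qed.

Lemma dotDr u v w : dot w (u + v) = dot w u + dot w v.
Proof. by rewrite dotC dotDl !(dotC w). Qed.

Lemma dotZr a u v : dot v (a *: u) = a * dot v u.
Proof. by rewrite dotC dotZl dotC. Qed.

Lemma dotNl u v : dot (- u) v = - dot u v.
Proof. by rewrite -scaleN1r dotZl mulN1r. Qed.

Lemma dotNr u v : dot v (- u) = - dot v u.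
Proof. by rewrite dotC dotNl dotC. Qed.

Definition dotE := (dotDl, dotDr, dotNl, dotNr, dotZl, dotZr).

Lemma dot_ge0 u : 0 <= dot u u.
Proof. by apply: sumr_ge0 => i _; rewrite -expr2 sqr_ge0. Qed.

Lemma dot_eq0 u : dot u u = 0 -> u = 0.
Proof.
move=> /eqP; rewrite psumr_eq0; last by move=> i _; rewrite -expr2 sqr_ge0.
move=> /allP u0; apply/rowP => i; rewrite mxE; apply/eqP.
by have := u0 i (mem_index_enum _); rewrite -expr2 sqrf_eq0.
Qed.

Lemma enorm_ge0 u : 0 <= enorm u. Proof. exact: sqrtr_ge0. Qed.

Lemma sqr_enorm u : enorm u ^+ 2 = dot u u.
Proof. by rewrite sqr_sqrtr // dot_ge0. Qed.

Lemma enorm_le u c : 0 <= c -> (enorm u <= c) = (dot u u <= c ^+ 2).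
Proof. by move=> c0; rewrite -sqr_enorm ler_sqr ?nnegrE ?enorm_ge0. Qed.

Lemma le_enorm u c : 0 <= c -> (c <= enorm u) = (c ^+ 2 <= dot u u).
Proof. by move=> c0; rewrite -sqr_enorm ler_sqr ?nnegrE ?enorm_ge0. Qed.

Lemma enorm_eq0 u : enorm u = 0 -> u = 0.
Proof. by move=> u0; apply: dot_eq0; rewrite -sqr_enorm u0 expr0n. Qed.

Lemma enorm0 : enorm (0 : 'rV[R]_d) = 0.
Proof. by apply/eqP; rewrite -sqrf_eq0 sqr_enorm -(scale0r 0) dotZl mul0r. Qed.

Lemma enormZ a u : enorm (a *: u) = `|a| * enorm u.
Proof.
apply/eqP; rewrite -(@eqrXn2 _ 2) ?mulr_ge0 ?enorm_ge0 //.
by rewrite exprMn !sqr_enorm !dotE real_normK ?num_real // expr2 mulrA.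
Qed.

Lemma enormN u : enorm (- u) = enorm u.
Proof. by rewrite -scaleN1r enormZ normrN1 mul1r. Qed.

Lemma enormB u v : enorm (u - v) = enorm (v - u).
Proof. by rewrite -enormN opprB. Qed.

Lemma dot_le_enorm u v : dot u v <= enorm u * enorm v.
Proof.
have [u0|u0] := eqVneq (enorm u) 0.
  by rewrite u0 mul0r (enorm_eq0 u0) -(scale0r 0) dotZl mul0r.
have [v0|v0] := eqVneq (enorm v) 0.
  by rewrite v0 mulr0 (enorm_eq0 v0) -(scale0r 0) dotZr mul0r.
have uv_gt0 : 0 < enorm u * enorm v by rewrite mulr_gt0 // lt_def enorm_ge0 andbT.
have := dot_ge0 (enorm v *: u - enorm u *: v).
rewrite !dotE -!sqr_enorm (dotC v u).
set a := enorm u in uv_gt0 *; set b := enorm v in uv_gt0 *; set p := dot u v => h.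
rewrite -(ler_pM2l uv_gt0); lra.
Qed.

Lemma enormD u v : enorm (u + v) <= enorm u + enorm v.
Proof.
rewrite enorm_le ?addr_ge0 ?enorm_ge0 // !dotE (dotC v u) -!sqr_enorm.
have := dot_le_enorm u v; lra.
Qed.

Lemma enorm_triangle v u w : enorm (u - w) <= enorm (u - v) + enorm (v - w).
Proof. by apply: le_trans (enormD _ _); rewrite subrKA. Qed.

Lemma coord_le_enorm u i : `|u 0 i| <= enorm u.
Proof.
rewrite -(@ler_sqr _ `|_|) ?nnegrE ?enorm_ge0 // real_normK ?num_real //.
rewrite sqr_enorm /dot (bigD1 i) //= -expr2 lerDl.
by apply: sumr_ge0 => j _; rewrite -expr2 sqr_ge0.
Qed.

End Euclidean.

(** A crude bound, without the square root of [d]: meshes and separations below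
may be multiplied by any function of [d] at no cost in the number of calls. *)
Lemma enorm_coord_le (R : realType) d (u : 'rV[R]_d) (c : R) :
  (forall i, `|u 0 i| <= c) -> enorm u <= d%:R * c.
Proof.
case: d u => [|n] u uc; first by rewrite thinmx0 enorm0 mul0r.
have c0 : 0 <= c by apply: le_trans (uc 0).
rewrite enorm_le ?mulr_ge0 ?ler0n //.
apply: (@le_trans _ _ (n.+1%:R * c ^+ 2)).
  rewrite mulr_natl -[X in _ *+ X](card_ord n.+1) -sumr_const.
  by apply: ler_sum => i _; rewrite -expr2 -real_normK ?num_real // ler_sqr ?nnegrE.
rewrite exprMn ler_wpM2r ?sqr_ge0 // expr2 -natrM ler_nat; exact: leq_pmulr.
Qed.

(** * Packing the unit ball *)

Section Packing.
Variables (R : realType) (d : nat).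
Implicit Types (x y : 'rV[R]_d) (X Y : seq 'rV[R]_d).

Definition spread (s : R) Y : Prop :=
  uniq Y /\ {in Y &, forall y z, y != z -> s <= enorm (y - z)}.

(** Two points further apart than [d] have distinct integer parts in some
coordinate. *)
Lemma size_spread_le (D A : R) Y : 0 <= A -> d%:R < D -> spread D Y ->
  {in Y, forall y, enorm y <= A} -> (size Y)%:R <= (2 * A + 1) ^+ d.
Proof.
move=> A0 dD [Yu Ys] YA.
pose cell y : {ffun 'I_d -> 'I_(Num.truncn (2 * A)).+1} :=
  [ffun i => inord (Num.truncn (y 0 i + A))].
have coordA y i : y \in Y -> `|y 0 i| <= A.
  by move=> /YA; apply: le_trans; exact: coord_le_enorm.
have cell_inj : {in Y &, injective cell}.
  move=> y z yY zY yz; apply/eqP/negP => /negP yNz.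
  have := Ys _ _ yY zY yNz; apply/negP; rewrite -ltNge.
  apply: le_lt_trans dD; rewrite -[d%:R]mulr1; apply: enorm_coord_le => i.
  have /(congr1 val) := congr1 (fun g : {ffun _} => g i) yz.
  have tr (w : 'rV[R]_d) : w \in Y ->
      [/\ (Num.truncn (w 0 i + A)%R < (Num.truncn (2 * A)%R).+1)%N,
       (Num.truncn (w 0 i + A))%:R <= w 0 i + A
       & w 0 i + A < (Num.truncn (w 0 i + A)).+1%:R].
    move=> /coordA => /(_ i); rewrite ler_norml => /andP[w1 w2].
    have w0 : 0 <= w 0 i + A by lra.
    have /andP[-> ->] := truncn_itv w0; split => //.
    by rewrite ltnS; apply: le_truncn; lra.
  have [y1 y2 y3] := tr _ yY; have [z1 z2 z3] := tr _ zY.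
  rewrite /cell !ffunE /= !inordK // => e; rewrite e in y2 y3.
  rewrite !mxE ler_norml; rewrite -natr1 in y3 z3; lra.
apply: (@le_trans _ _ (((Num.truncn (2 * A)).+1 ^ d)%N%:R)).
  rewrite ler_nat -(size_map cell) -(card_uniqP _) ?map_inj_in_uniq //.
  by apply: leq_trans (max_card _) _; rewrite card_ffun !card_ord.
rewrite natrX lerXn2r ?nnegrE ?ler0n //; first lra.
by rewrite -natr1 lerD2r truncn_le; lra.
Qed.

(** Placing a copy of [Y] around each point of a dilation of [X] multiplies the
cardinals; the dilation is just large enough to keep the copies [D] apart. The
half-separation [D / 2] is added to radii, as if counting disjoint balls. *)
Lemma spread_dilate (s D A : R) X Y :
  0 < s -> 0 < D -> 0 <= A ->
  spread s X -> {in X, forall x, enorm x <= 1} ->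
  spread D Y -> {in Y, forall y, enorm y <= A} ->
  exists Z, [/\ size Z = (size X * size Y)%N, spread D Z &
    {in Z, forall z, enorm z <= (1 + 2 / s) * (A + D / 2) - D / 2}].
Proof.
move=> s0 D0 A0 [Xu Xs] X1 [Yu Ys] YA.
pose al := (2 * A + D) / s.
have al0 : 0 <= al by rewrite divr_ge0 ?ltW //; lra.
have als : al * s = 2 * A + D by rewrite /al divfK // gt_eqF.
pose h x y := al *: x + y.
have far x x' y y' : x \in X -> x' \in X -> y \in Y -> y' \in Y ->
    (x, y) != (x', y') -> D <= enorm (h x y - h x' y').
  move=> xX x'X yY y'Y; rewrite xpair_eqE negb_and.
  have [-> /= yy'|xx' _] := eqVneq x x'.
    by rewrite /h opprD addrACA subrr add0r Ys.
  have e : al *: (x - x') = (h x y - h x' y') + (y' - y).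
    by rewrite /h; apply/rowP => i; rewrite !mxE; ring.
  have := enormD (h x y - h x' y') (y' - y); rewrite -e enormZ ger0_norm //.
  have := enormD y' (- y); rewrite enormN.
  have := YA _ yY; have := YA _ y'Y.
  have : al * s <= al * enorm (x - x') by rewrite ler_wpM2l ?Xs.
  rewrite als; lra.
exists [seq h x y | x <- X, y <- Y]; split; first exact: size_allpairs.
  split.
    apply: allpairs_uniq => // -[x y] [x' y'] /allpairsP[[a b]/= [aX bY [-> ->]]].
    move=> /allpairsP[[a' b']/= [a'X b'Y [-> ->]]] /= e.
    apply/eqP/negP => /negP /(far _ _ _ _ aX a'X bY b'Y).
    by rewrite e subrr enorm0 leNgt D0.
  move=> _ _ /allpairsP[[a b]/= [aX bY ->]] /allpairsP[[a' b']/= [a'X b'Y ->]].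
  move=> /negP ne; apply: far => //; apply/negP => /eqP[ea eb].
  by apply: ne; rewrite ea eb.
move=> _ /allpairsP[[a b]/= [aX bY ->]].
apply: le_trans (enormD _ _) _; rewrite enormZ ger0_norm //.
have : al * enorm a <= al by rewrite -[leRHS]mulr1 ler_wpM2l ?X1.
have := YA _ bY.
suff -> : (1 + 2 / s) * (A + D / 2) - D / 2 = al + A by lra.
by rewrite /al; field; rewrite gt_eqF.
Qed.

(** Iterating the dilation produces [size X ^ k] points that are [d + 1] apart
in a ball of radius proportional to [(1 + 2 / s) ^ k], where only a multiple of
[(1 + 2 / s) ^ (k * d)] fit. This self-similarity replaces the comparison of
volumes. *)
Lemma size_spread_unit_ball (s : R) X : 0 < s -> spread s X ->
  {in X, forall x, enorm x <= 1} -> (size X)%:R <= (1 + 2 / s) ^+ d.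
Proof.
move=> s0 Xs X1; set lam := 1 + 2 / s.
have lam1 : 1 <= lam by rewrite lerDl divr_ge0 ?ltW.
have lam0 : 0 < lam by lra.
pose D : R := d%:R + 1; have D0 : 0 < D by rewrite ltr_wpDl.
pose A k := (lam ^+ k - 1) * (D / 2).
have A0 k : 0 <= A k.
  by rewrite mulr_ge0 ?divr_ge0 ?subr_ge0 ?exprn_ege1 // ltW.
have fractal k : exists Y, [/\ size Y = (size X ^ k)%N, spread D Y &
    {in Y, forall y, enorm y <= A k}].
  elim: k => [|k [Y [Ysz Ys YA]]].
    exists [:: 0]; split => //.
      by split => // x y; rewrite !inE => /eqP-> /eqP->; rewrite eqxx.
    by move=> y; rewrite inE => /eqP->; rewrite enorm0 A0.
  have [Z [Zsz Zs ZA]] := spread_dilate s0 D0 (A0 k) Xs X1 Ys YA.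
  exists Z; split => //; first by rewrite Zsz Ysz expnS.
  move=> z /ZA; congr (_ <= _).
  by rewrite /A -/lam exprS; ring.
have pow_le k : (size X)%:R ^+ k <= (lam ^+ d) ^+ k * (D + 1) ^+ d.
  have [Y [Ysz Ys YA]] := fractal k.
  rewrite -natrX -Ysz.
  apply: le_trans (size_spread_le (A0 k) _ Ys YA) _; first by rewrite ltrDl.
  rewrite -exprM mulnC exprM -exprMn; have lamk1 : 1 <= lam ^+ k by rewrite exprn_ege1.
  apply: lerXn2r; rewrite ?nnegrE.
  - by have := A0 k; lra.
  - by rewrite mulr_ge0 //; lra.
  - by rewrite /A; lra.
(* A ratio above 1 would have powers unbounded by Bernoulli's inequality,
   although the previous bound caps them all by one constant. *)
rewrite leNgt; apply/negP => big.
have lamd0 : 0 < lam ^+ d by rewrite exprn_gt0.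
pose q := (size X)%:R / lam ^+ d - 1.
have q0 : 0 < q by rewrite subr_gt0 ltr_pdivlMr // mul1r.
have bern k : 1 + k%:R * q <= (1 + q) ^+ k.
  elim: k => [|k IH]; first by rewrite mul0r addr0 expr0.
  rewrite exprS -natr1.
  have : (1 + q) * (1 + k%:R * q) <= (1 + q) * (1 + q) ^+ k by rewrite ler_wpM2l //; lra.
  have : 0 <= k%:R * q * q by rewrite !mulr_ge0 // ltW.
  by lra.
have qk k : (1 + q) ^+ k <= (D + 1) ^+ d.
  rewrite /q addrC subrK expr_div_n ler_pdivrMr ?exprn_gt0 // mulrC.
  exact: pow_le.
pose k := Num.bound ((D + 1) ^+ d / q).
have : (D + 1) ^+ d / q < k%:R.
  by apply: archi_boundP; rewrite divr_ge0 ?exprn_ge0 ?ltW //; lra.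
rewrite ltr_pdivrMr // => kq.
have := le_trans (bern k) (qk k); lra.
Qed.

End Packing.

(** * Sublinear functions and convex hulls *)

Section Sublinear.
Variables (R : realType) (d : nat).
Implicit Types (u v e g : 'rV[R]_d) (p q : 'rV[R]_d -> R).

Definition sublinear p : Prop :=
  (forall u v, p (u + v) <= p u + p v) /\
  (forall (t : R) u, 0 <= t -> p (t *: u) = t * p u).

Lemma sublinear0 p : sublinear p -> p 0 = 0.
Proof. by move=> [_ ph]; rewrite -(scale0r 0) ph // mul0r. Qed.

Lemma sublinear_opp_ge p u : sublinear p -> - p (- u) <= p u.
Proof.
move=> ps; have [pD _] := ps.
by have := pD u (- u); rewrite subrr (sublinear0 ps); lra.
Qed.

(** The witness is the one-sided directional derivative of [p] at the point [e]:
the increment [p (v + t *: e) - t * p e] is nonincreasing in [t], so that its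
infimum is its limit, and homogeneity turns [p (v + t *: e) - p (t *: e)] into
the difference quotient of [p] at [e] in direction [v] with step [t^-1]. *)
Lemma sublinear_tangent p e : sublinear p ->
  exists q, [/\ sublinear q, forall v, q v <= p v & q (- e) <= - p e].
Proof.
move=> ps; have [pD ph] := ps.
pose S v := [set p (v + t *: e) - t * p e | t in [set t : R | 0 <= t]].
have Slb v : lbound (S v) (- p (- v)).
  move=> _ [t /= t0 <-]; have := pD (v + t *: e) (- v).
  by rewrite addrAC subrr add0r ph //; lra.
have Sinf v : has_inf (S v).
  split; last by exists (- p (- v)).
  by exists (p (v + 0 *: e) - 0 * p e); exists 0 => //=; rewrite lexx.
have Sle v t : 0 <= t -> inf (S v) <= p (v + t *: e) - t * p e.
  by move=> t0; apply: ge_inf; [case: (Sinf v)|exists t].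
have Sge v (b : R) : (forall t, 0 <= t -> b <= p (v + t *: e) - t * p e) ->
    b <= inf (S v).
  move=> h; apply: lb_le_inf; first by case: (Sinf v).
  by move=> _ [t /= t0 <-]; apply: h.
have S0 : inf (S 0) = 0.
  apply/eqP; rewrite eq_le; apply/andP; split.
    by have := Sle 0 0 (lexx _); rewrite scale0r addr0 mul0r subr0 (sublinear0 ps).
  by apply: Sge => t t0; rewrite add0r ph // subrr.
have Shom t v : 0 < t -> t * inf (S v) <= inf (S (t *: v)).
  move=> t0; apply: Sge => s s0.
  have -> : t *: v + s *: e = t *: (v + (s / t) *: e).
    by rewrite scalerDr scalerA mulrCA divff ?mulr1 ?gt_eqF.
  rewrite (ph _ _ (ltW t0)).
  have Slet := Sle v (s / t) (divr_ge0 s0 (ltW t0)).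
  have -> : s * p e = t * (s / t * p e) by rewrite mulrA mulrCA divff ?mulr1 // gt_eqF.
  by rewrite -mulrBr; apply: ler_wpM2l => //; apply: ltW.
exists (fun v => inf (S v)); split.
- split=> [u v|t u].
    rewrite -lerBlDr; apply: (Sge) => t t0; rewrite lerBlDr -lerBlDl.
    apply: Sge => s s0.
    have := Sle (u + v) (t + s) (addr_ge0 t0 s0).
    rewrite scalerDl addrACA; have := pD (u + t *: e) (v + s *: e); lra.
  rewrite le_eqVlt => /predU1P[<-|t0]; first by rewrite scale0r S0 mul0r.
  apply/eqP; rewrite eq_le Shom // andbT.
  rewrite -(ler_pM2l (_ : 0 < t^-1)) ?invr_gt0 //.
  apply: le_trans (Shom _ _ _) _; rewrite ?invr_gt0 //.
  by rewrite scalerA mulVf ?gt_eqF // scale1r mulKf // gt_eqF.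
- by move=> v; have := Sle v 0 (lexx _); rewrite scale0r addr0 mul0r subr0.
- have := Sle (- e) 1 ler01.
  by rewrite scale1r addNr (sublinear0 ps) mul1r sub0r.
Qed.

(** The Hahn-Banach theorem in finite dimension. Replacing [p] by its derivative
at [u], and the result by its derivative at each vector of the canonical basis
in turn, only decreases the function and preserves the oddness obtained at the
earlier vectors. What is left is sublinear and odd on the basis, hence linear. *)
Lemma sublinear_supported p u : sublinear p ->
  exists g, (forall v, dot g v <= p v) /\ p u <= dot g u.
Proof.
move=> /(sublinear_tangent u) [p0 [p0s p0p p0u]].
have [q [qs qp qodd]] : exists q, [/\ sublinear q, forall v, q v <= p0 v &
    forall i, i \in enum 'I_d -> q (- delta_mx 0 i) <= - q (delta_mx 0 i)].
  elim: (enum 'I_d) => [|i s [q [qs qp qodd]]]; first by exists p0.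
  have [q' [q's q'q q'i]] := sublinear_tangent (delta_mx 0 i) qs.
  exists q'; split => //; first by move=> v; apply: le_trans (qp v).
  move=> j; rewrite inE => /predU1P[->|/qodd qj].
    by apply: le_trans q'i _; rewrite lerN2.
  by apply: le_trans (q'q _) _; apply: le_trans qj _; rewrite lerN2.
have [qD qh] := qs.
have qscale a i : q (a *: delta_mx 0 i) <= a * q (delta_mx 0 i).
  have [a0|a0] := leP 0 a; first by rewrite qh.
  have na0 : 0 <= - a by rewrite oppr_ge0 ltW.
  rewrite -mulrNN -[in leLHS](opprK a) scaleNr -scalerN qh //.
  by rewrite ler_wpM2l //; apply: qodd; rewrite mem_enum.
pose g : 'rV[R]_d := \row_i q (delta_mx 0 i).
have gq v : dot g v <= q v.
  apply: le_trans (sublinear_opp_ge v qs); rewrite lerNr.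
  have qsum (s : seq 'I_d) : q (\sum_(i <- s) (- v 0 i) *: delta_mx 0 i) <=
      \sum_(i <- s) - v 0 i * q (delta_mx 0 i).
    elim: s => [|i s IH]; first by rewrite !big_nil (sublinear0 qs).
    by rewrite !big_cons; apply: le_trans (qD _ _) _; apply: lerD.
  have := qsum (index_enum 'I_d).
  have -> : \sum_i (- v 0 i) *: delta_mx 0 i = - v.
    by rewrite [in RHS](row_sum_delta v) -sumrN; apply: eq_bigr => i _; rewrite scaleNr.
  move=> /le_trans; apply.
  by rewrite -sumrN; apply: ler_sum => i _; rewrite !mxE mulNr mulrC.
exists g; split=> [v|]; first exact: le_trans (gq v) (le_trans (qp v) (p0p v)).
have := le_trans (gq (- u)) (le_trans (qp (- u)) p0u).
by rewrite dotNr lerN2.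
Qed.

End Sublinear.

Section ConvexHull.
Variables (R : realType) (d : nat).
Implicit Types (S C : set 'rV[R]_d) (g u : 'rV[R]_d).

Lemma sub_conv S : S `<=` Defs.conv S.
Proof. exact: sub_smallest. Qed.

Lemma conv_convex S g u (t : R) : Defs.conv S g -> Defs.conv S u -> 0 <= t <= 1 ->
  Defs.conv S (t *: g + (1 - t) *: u).
Proof.
move=> gS uS /andP[t0 t1] C [Cc SC].
have gC : C g by apply: gS. have uC : C u by apply: uS.
pose l : {i01 R} := Itv01 t0 t1.
by have := Cc g u l; rewrite !inE; apply.
Qed.

Lemma conv_enorm_le S (L : R) : 0 <= L -> (forall g, S g -> enorm g <= L) ->
  forall g, Defs.conv S g -> enorm g <= L.
Proof.
move=> L0 SL g; apply: (_ : Defs.conv S `<=` [set g | enorm g <= L]).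
apply: smallest_sub => // x y l; rewrite !inE /= => xL yL.
apply: le_trans (enormD _ _) _; rewrite !enormZ.
have l0 : 0 <= l%:num by []. have l1 : l%:num <= 1 by [].
rewrite !ger0_norm ?subr_ge0 //.
have -> : L = l%:num * L + (1 - l%:num) * L by ring.
by apply: lerD; rewrite ler_wpM2l ?subr_ge0.
Qed.

End ConvexHull.

(** * The Clarke and Goldstein subdifferentials *)

Section Clarke.
Variables (R : realType) (d : nat) (f : 'rV[R]_d -> R) (L : R).
Hypothesis f_lip : forall x y, `|f x - f y| <= L * enorm (x - y).
Implicit Types (x y u v g : 'rV[R]_d).

Let quot v (p : 'rV[R]_d * R) : R := (f (p.1 + p.2 *: v) - f p.1) / p.2.

Local Notation near_base x := (filter_prod (nbhs (x : 'rV[R]_d)) (0 : R)^'+).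

Lemma quot_bound v p : 0 < p.2 -> `|quot v p| <= L * enorm v.
Proof.
move=> p0; rewrite /quot normrM normfV (gtr0_norm p0) ler_pdivrMr //.
apply: le_trans (f_lip _ _) _.
by rewrite addrAC subrr add0r enormZ (gtr0_norm p0) mulrCA mulrC.
Qed.

Lemma near_pos x : \forall p \near near_base x, 0 < p.2.
Proof.
by exists (setT, [set t : R | 0 < t]) => [|p [_ /=]//]; split=> /=;
  [exact: filterT|exact: nbhs_right_gt].
Qed.

Lemma clarke_deriv_le x v c : (\forall p \near near_base x, quot v p <= c) ->
  (clarke_deriv f x v <= c%:E)%E.
Proof.
move=> h.
apply: (@le_trans _ _ (ereal_sup ((fun p => (quot v p)%:E) @` [set p | quot v p <= c]))).
  by apply: ereal_inf_lbound; exists [set p | quot v p <= c].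
by apply: ge_ereal_sup => _ [p /= pc <-]; rewrite lee_fin.
Qed.

Lemma clarke_deriv_lt x v c : (clarke_deriv f x v < c%:E)%E ->
  \forall p \near near_base x, quot v p <= c.
Proof.
move=> /ereal_inf_lt[_ [V FV <-]] sup_lt.
apply: filterS FV => p Vp; rewrite -lee_fin; apply: le_trans (ltW sup_lt).
by apply: ereal_sup_ubound; exists p.
Qed.

Lemma clarke_deriv_ge x v : ((- (L * enorm v))%:E <= clarke_deriv f x v)%E.
Proof.
apply: le_ereal_inf_tmp => _ [V FV <-].
have [p [Vp p0]] := filter_ex (filterI FV (near_pos x)).
apply: le_ereal_sup_tmp; exists (quot v p)%:E; first by exists p.
by rewrite lee_fin; have := quot_bound v p0; rewrite ler_norml => /andP[].
Qed.

Lemma clarke_deriv_le_enorm x v : (clarke_deriv f x v <= (L * enorm v)%:E)%E.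
Proof.
apply: clarke_deriv_le; apply: filterS (near_pos x) => p p0.
exact: le_trans (ler_norm _) (quot_bound v p0).
Qed.

(* The derivative is finite because [f] is Lipschitz. *)
Let cd x v : R := fine (clarke_deriv f x v).

Let cdE x v : clarke_deriv f x v = (cd x v)%:E.
Proof.
rewrite /cd fineK // fin_numE -!ltNye -ltey; apply/andP; split.
  exact: lt_le_trans (ltNyr _) (clarke_deriv_ge x v).
exact: le_lt_trans (clarke_deriv_le_enorm x v) (ltry _).
Qed.

Let cd_le x v c : (\forall p \near near_base x, quot v p <= c) -> cd x v <= c.
Proof. by move=> /clarke_deriv_le; rewrite cdE lee_fin. Qed.

Let near_quot x v (e : R) : 0 < e ->
  \forall p \near near_base x, quot v p <= cd x v + e.
Proof. by move=> e0; apply: clarke_deriv_lt; rewrite cdE lte_fin ltrDl. Qed.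

Lemma near_base_scale x (t : R) : 0 < t ->
  (fun p : 'rV[R]_d * R => (p.1, p.2 * t)) @ near_base x --> near_base x.
Proof.
move=> t0 A [[P Q] [/= xP [e /= e0 Qe]] PQ].
exists (P, [set s | Q (s * t)]); last by move=> [y s] [/= Py Qs]; exact: PQ.
split=> //; exists (e / t); first by rewrite /= divr_gt0.
move=> s /=; rewrite !sub0r !normrN ltr_pdivlMr // => st s0; apply: Qe => /=; last exact: mulr_gt0.
by rewrite sub0r normrN normrM (gtr0_norm t0).
Qed.

(** The limit superior that defines the Clarke derivative lets the base point
move; this is what makes the derivative subadditive, as the increment along
[u + v] can be cut at the displaced base point. *)
Lemma near_base_shift x u :
  (fun p : 'rV[R]_d * R => (p.1 + p.2 *: u, p.2)) @ near_base x --> near_base x.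
Proof.
have shift_cvg : p.1 + p.2 *: u @[p --> near_base x] --> x.
  rewrite -[x in _ --> x]addr0 -[X in _ + X](scale0r u).
  apply: cvgD; first exact: cvg_fst.
  by apply: cvgZr_tmp; apply: cvg_trans cvg_snd _; apply: cvg_within.
move=> A [[P Q] [/= xP xQ] PQ].
rewrite /= !near_simpl; near=> p; apply: PQ; split=> /=; near: p.
  exact: shift_cvg xP.
exact: cvg_snd xQ.
Unshelve. all: by end_near.
Qed.

Lemma clarke_deriv_sublinear x : sublinear (cd x).
Proof.
have cd0 : cd x 0 = 0.
  apply/eqP; rewrite eq_le -!lee_fin -!cdE; apply/andP; split.
    by have := clarke_deriv_le_enorm x 0; rewrite enorm0 mulr0.
  by have := clarke_deriv_ge x 0; rewrite enorm0 mulr0 oppr0.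
have hom_le (t : R) v : 0 < t -> cd x (t *: v) <= t * cd x v.
  move=> t0; apply/ler_addgt0Pr => e e0; apply: cd_le.
  have et : 0 < e / t by rewrite divr_gt0.
  have := near_base_scale t0 (near_quot x v et).
  apply: filterS2 (near_pos x) => p p0 /=; rewrite /quot /= scalerA ler_pdivrMr ?mulr_gt0 // => h.
  have -> : t * cd x v + e = t * (cd x v + e / t).
    by rewrite mulrDr mulrCA divff ?mulr1 // gt_eqF.
  by rewrite ler_pdivrMr // (mulrC t) -mulrA (mulrC t).
split=> [u v|t v].
  apply/ler_addgt0Pr => e e0; apply: cd_le.
  have e2 : 0 < e / 2 by rewrite divr_gt0.
  have := near_base_shift u (near_quot x v e2).
  apply: filterS2 (near_quot x u e2) => p; rewrite /quot /= => hu hv.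
  have -> : f (p.1 + p.2 *: (u + v)) - f p.1 = (f (p.1 + p.2 *: u + p.2 *: v) - f (p.1 + p.2 *: u))
      + (f (p.1 + p.2 *: u) - f p.1) by rewrite scalerDr addrA subrKA.
  by rewrite mulrDl; lra.
rewrite le_eqVlt => /predU1P[<-|t0]; first by rewrite scale0r cd0 mul0r.
apply/eqP; rewrite eq_le hom_le //=.
rewrite -(ler_pM2l (_ : 0 < t^-1)) ?invr_gt0 // mulKf ?gt_eqF //.
have := hom_le t^-1 (t *: v); rewrite invr_gt0 scalerA mulVf ?gt_eqF // scale1r.
exact.
Qed.

(** With the inequality that defines [clarke_subdiff], this says that the Clarke
derivative is the support function of the Clarke subdifferential. *)
Lemma clarke_subdiff_supported x u :
  exists2 g, clarke_subdiff f x g & (clarke_deriv f x u <= (dot g u)%:E)%E.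
Proof.
have [g [gle uge]] := sublinear_supported u (clarke_deriv_sublinear x).
by exists g => [v|]; rewrite cdE lee_fin.
Qed.

Lemma clarke_subdiff_enorm_le x g : 0 <= L -> clarke_subdiff f x g -> enorm g <= L.
Proof.
move=> L0 /(_ g) gg; have := le_trans gg (clarke_deriv_le_enorm x g).
rewrite lee_fin -sqr_enorm expr2 => h.
have [->//|g0] := eqVneq (enorm g) 0.
by move: h; rewrite ler_pM2r // lt_def g0 enorm_ge0.
Qed.

(** A mean value inequality, by real induction on the set [S] of times at which
the bound, relaxed to a slope [c' > c], holds. The difference quotients are
bounded by [c'] uniformly around the point reached at time [sup S], hence from
some time of [S] slightly before it, which carries the bound past [sup S]. *)
Lemma clarke_mean_value x u (delta c : R) : 0 < delta ->
  (forall t, 0 <= t <= delta -> (clarke_deriv f (x + t *: u) u <= c%:E)%E) ->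
  f (x + delta *: u) <= f x + c * delta.
Proof.
move=> del0 fc; apply/ler_addgt0Pr => e e0.
pose c' := c + e / delta.
have cc' : c < c' by rewrite ltrDl divr_gt0.
have -> : f x + c * delta + e = f x + c' * delta.
  by rewrite /c' mulrDl addrA divfK // gt_eqF.
pose S := [set t : R | 0 <= t <= delta /\ f (x + t *: u) <= f x + c' * t].
have S0 : S 0 by split; rewrite ?lexx ?(ltW del0) // scale0r mulr0 !addr0.
have Ssup : has_sup S by split; [exists 0|exists delta => t [/andP[]]].
have s_ge t : S t -> t <= sup S by move=> St; apply: ub_le_sup => //; case: Ssup.
have s_dom : 0 <= sup S <= delta.
  by rewrite s_ge //=; apply: ge_sup => [|t [/andP[]]//]; exists 0.
have /clarke_deriv_lt : (clarke_deriv f (x + sup S *: u) u < c'%:E)%E.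
  by apply: le_lt_trans (fc _ s_dom) _; rewrite lte_fin.
move=> [[P Q] [/= sP [r2 /= r20 Qr2]] PQ].
have : (fun t : R => x + t *: u) @ sup S --> x + sup S *: u.
  by apply: cvgD; [exact: cvg_cst|apply: cvgZr_tmp; exact: cvg_id].
move=> /(_ _ sP) [r1 /= r10 Pr1].
pose r := Num.min r1 r2.
have r0 : 0 < r by rewrite lt_min r10.
have [rr1 rr2] : r <= r1 /\ r <= r2 by rewrite /r !ge_min !lexx orbT.
have [t St tr] := sup_adherent (divr_gt0 r0 (ltr0Sn _ 1)) Ssup.
have ts := s_ge _ St.
have [/andP[t0 td] ft] := St.
have [tdelta|tNd] := eqVneq t delta; first by rewrite -tdelta.
have step h : 0 < h -> h < r -> t + h <= delta -> S (t + h).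
  move=> h0 hr thd; split; first by rewrite thd addr_ge0 // ltW.
  have := PQ (x + t *: u, h); rewrite /quot /=.
  have -> : x + t *: u + h *: u = x + (t + h) *: u by rewrite scalerDl addrA.
  rewrite ler_pdivrMr // => hq.
  have : f (x + (t + h) *: u) - f (x + t *: u) <= c' * h.
    apply: hq; split=> /=; last by apply: Qr2 => //=; rewrite sub0r normrN gtr0_norm //; lra.
    by apply: Pr1 => /=; rewrite ger0_norm ?subr_ge0 //; lra.
  by rewrite mulrDr; lra.
have td0 : t < delta by rewrite lt_neqAle tNd.
have [far|close] := leP (t + r * 3 / 4) delta.
  have h34 : 0 < r * 3 / 4 by lra.
  have := s_ge _ (step _ h34 _ far); lra.
have := step (delta - t); rewrite subrKC => -[]; lra.
Qed.

End Clarke.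

Section Goldstein.
Variables (R : realType) (d : nat).

(** With [m > eps] the infimum of the norm over [C], a point [g0] of [C] with
norm [b] close enough to [m] does the work of a point of minimal norm in the
closure of [C]. If [dot g g0 < eps * b], then moving from [g0] towards [g] by a
fraction [t] changes the squared norm by at most
[2 t (eps b - b ^ 2) + 4 L ^ 2 t ^ 2], which the choice of [t] makes at most
[- 4 L ^ 2 t ^ 2]; this beats the excess of [b ^ 2] over [m ^ 2], and the norm
drops below the infimum. *)
Lemma convex_norm_separation (C : set 'rV[R]_d) (L eps : R) :
  C !=set0 -> 0 < L -> 0 < eps ->
  (forall g h (t : R), C g -> C h -> 0 <= t <= 1 -> C (t *: g + (1 - t) *: h)) ->
  (forall g, C g -> enorm g <= L) ->
  (eps%:E < ereal_inf [set (enorm g)%:E | g in C])%E ->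
  exists2 u, enorm u = 1 & forall g, C g -> dot g u <= - eps.
Proof.
move=> [h Ch] L0 eps0 Cconv CL eps_lt.
pose N := [set enorm g | g in C].
have N_inf : has_inf N.
  by split; [exists (enorm h), h|exists 0 => _ [g _ <-]; exact: enorm_ge0].
pose m := inf N.
have m_le g : C g -> m <= enorm g by move=> Cg; apply: ge_inf; [case: N_inf|exists g].
have eps_m : eps < m.
  have [r er rN] : exists2 r : R, eps < r & forall g, C g -> r <= enorm g.
    have fin_inf : ereal_inf [set (enorm g)%:E | g in C] \is a fin_num.
      rewrite fin_numE -ltNye -ltey; apply/andP; split.
        exact: lt_trans (ltNyr _) eps_lt.
      apply: le_lt_trans (_ : _ <= (enorm h)%:E)%E (ltry _).
      by apply: ereal_inf_lbound; exists h.
    exists (fine (ereal_inf [set (enorm g)%:E | g in C])).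
      by rewrite -lte_fin fineK.
    move=> g Cg; rewrite -lee_fin fineK //; apply: ereal_inf_lbound.
    by exists g.
  apply: (lt_le_trans er); apply: lb_le_inf; first by case: N_inf.
  by move=> _ [g Cg <-]; exact: rN.
have mL : m <= L by apply: le_trans (m_le _ Ch) (CL _ Ch).
pose t := m * (m - eps) / (4 * L ^+ 2).
have L2 : 0 < 4 * L ^+ 2 by rewrite mulr_gt0 // exprn_gt0.
have tE : t * (4 * L ^+ 2) = m * (m - eps) by rewrite divfK // gt_eqF.
have m0 : 0 < m by lra.
have t0 : 0 < t by apply: divr_gt0 L2; apply: mulr_gt0 => //; rewrite subr_gt0.
have t1 : t <= 1 by rewrite ler_pdivrMr //; nra.
clearbody t.
have [_ [g0 Cg0 <-] g0m] := inf_adherent (mulr_gt0 L0 (exprn_gt0 2 t0)) N_inf.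
rewrite -/m in g0m.
have mg0 := m_le _ Cg0; have g0L := CL _ Cg0.
set b := enorm g0 in g0m mg0 g0L.
have b0 : 0 < b by lra.
exists (- b^-1 *: g0).
  by rewrite enormZ normrN normfV (gtr0_norm b0) mulVf // gt_eqF.
move=> g Cg; rewrite dotZr mulNr lerN2 mulrC ler_pdivlMr //.
rewrite leNgt; apply/negP => short.
have gL := CL _ Cg.
have t01 : 0 <= t <= 1 by rewrite t1 ltW.
have := m_le _ (Cconv g g0 t Cg Cg0 t01).
rewrite le_enorm; last by lra.
have := dot_le_enorm g (- g0); rewrite dotNr enormN -/b.
rewrite !dotE -!sqr_enorm (dotC g0 g) -/b; move: short.
set p := dot g g0; set a := enorm g in gL *.
have a0 : 0 <= a by apply: enorm_ge0.
move=> short p_ge m_le2.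
have m2 : m ^+ 2 <= b ^+ 2 + 2 * t * (p - b ^+ 2) + t ^+ 2 * (a ^+ 2 - 2 * p + b ^+ 2).
  by apply: le_trans m_le2 _; rewrite le_eqVlt; apply/orP; left; apply/eqP; ring.
have q1 : a ^+ 2 - 2 * p + b ^+ 2 <= 4 * L ^+ 2.
  have : (a + b) ^+ 2 <= (2 * L) ^+ 2 by rewrite lerXn2r ?nnegrE //; lra.
  by rewrite sqrrD exprMn; move: p_ge; rewrite -/a; lra.
have q2 : t ^+ 2 * (a ^+ 2 - 2 * p + b ^+ 2) <= t * (m * (m - eps)).
  by rewrite -tE expr2 -mulrA ler_pM2l // ler_pM2l.
have q3 : 2 * t * (p - b ^+ 2) <= 2 * t * (m * (eps - m)).
  rewrite ler_pM2l ?mulr_gt0 //.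
  have : m * (m - eps) <= b * (b - eps) by apply: ler_pM; lra.
  by lra.
have q4 : b ^+ 2 - m ^+ 2 < 2 * L * (L * t ^+ 2).
  have : (b - m) * (b + m) < (L * t ^+ 2) * (2 * L).
    apply: (@le_lt_trans _ _ ((b - m) * (2 * L))); first by rewrite ler_wpM2l; lra.
    by rewrite ltr_pM2r; lra.
  by lra.
have q5 : t * (m * (m - eps)) = 4 * L ^+ 2 * t ^+ 2 by rewrite -tE; ring.
have : 0 < L ^+ 2 * t ^+ 2 by rewrite mulr_gt0 // exprn_gt0.
lra.
Qed.

Variables (f : 'rV[R]_d -> R) (L delta eps : R) (x : 'rV[R]_d).
Hypothesis f_lip : forall x y, `|f x - f y| <= L * enorm (x - y).
Hypotheses (L0 : 0 < L) (delta0 : 0 < delta) (eps0 : 0 < eps).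

Lemma goldstein_enorm_le g : goldstein_subdiff delta f x g -> enorm g <= L.
Proof.
apply: conv_enorm_le => [|h [y _]]; first exact: ltW.
by apply: clarke_subdiff_enorm_le => //; exact: ltW.
Qed.

Lemma clarke_sub_goldstein y : eball x delta y ->
  clarke_subdiff f y `<=` goldstein_subdiff delta f x.
Proof. by move=> xy g gy; apply: sub_conv; exists y. Qed.

Lemma goldstein_neq0 : goldstein_subdiff delta f x !=set0.
Proof.
have [g gx _] := clarke_subdiff_supported f_lip x 0.
exists g; apply: (clarke_sub_goldstein (y := x)) => //.
by rewrite /eball /= subrr enorm0 ltW.
Qed.

Lemma lipschitz_goldstein_stationary : L <= eps ->
  goldstein_stationary delta eps f x.
Proof.
move=> Leps; have [g Cg] := goldstein_neq0.
apply: le_trans (_ : _ <= (enorm g)%:E)%E _; first by apply: ereal_inf_lbound; exists g.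
by rewrite lee_fin (le_trans _ Leps) // goldstein_enorm_le.
Qed.

(** If [x] is not stationary, a direction [u] separates the Goldstein
subdifferential from the ball of radius [eps]. All the Clarke subdifferentials
along the segment from [x] to [x + delta *: u] lie in it, so that the Clarke
derivatives in direction [u] are at most [- eps] all along the segment. *)
Lemma goldstein_descent : ~ goldstein_stationary delta eps f x ->
  exists2 u, enorm u = 1 & f (x + delta *: u) <= f x - delta * eps.
Proof.
move=> /negP; rewrite -ltNge => eps_lt.
have [|u u1 uC] := convex_norm_separation goldstein_neq0 L0 eps0 _ goldstein_enorm_le eps_lt.
  by move=> g h t; exact: conv_convex.
exists u => //; have -> : f x - delta * eps = f x + - eps * delta by ring.
apply: (clarke_mean_value delta0) => t /andP[t0 tdelta].
have [g gy gu] := clarke_subdiff_supported f_lip (x + t *: u) u.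
apply: le_trans gu _; rewrite lee_fin; apply: uC.
apply: clarke_sub_goldstein gy.
by rewrite /eball /= addrAC subrr add0r enormZ u1 mulr1 ger0_norm.
Qed.

End Goldstein.

(** * Computability by a real-arithmetic machine *)

(** Each closure rule is restated for functions applied to an argument, such as
[fun a => f a + g a], so that the computability of an explicit program follows
by recursion on its syntax. *)
Section BssCombinators.
Variable R : realType.
Local Notation comp := (@bss_computable R _ _).

Lemma bss_ext A B (f g : A -> B) : f =1 g -> comp f -> comp g.
Proof. by move=> /funext ->. Qed.

Lemma bss_app A B C (g : B -> C) (f : A -> B) :
  comp g -> comp f -> comp (fun a => g (f a)).
Proof. exact: bss_comp. Qed.

Lemma bss_fst_of A B C (f : A -> B * C) : comp f -> comp (fun a => (f a).1).
Proof. exact/bss_app/bss_fst. Qed.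

Lemma bss_snd_of A B C (f : A -> B * C) : comp f -> comp (fun a => (f a).2).
Proof. exact/bss_app/bss_snd. Qed.

Lemma bss_andb A (f g : A -> bool) : comp f -> comp g -> comp (fun a => f a && g a).
Proof. by move=> cf cg; apply: (bss_if cf cg (bss_bool R A false)). Qed.

Lemma bss_orb A (f g : A -> bool) : comp f -> comp g -> comp (fun a => f a || g a).
Proof. by move=> cf cg; apply: (bss_if cf (bss_bool R A true) cg). Qed.

Lemma bss_natc A (n : nat) : comp (fun _ : A => n).
Proof. by elim: n => [|n IH]; [exact: bss_zero|exact: bss_app (bss_succ R) IH]. Qed.

Lemma bss_succn A (n : A -> nat) : comp n -> comp (fun a => (n a).+1).
Proof. exact/bss_app/bss_succ. Qed.

Lemma bss_iteri A B (n : A -> nat) (f : A -> B) (g : A -> nat -> B -> B) :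
  comp n -> comp f -> comp (fun p : A * nat * B => g p.1.1 p.1.2 p.2) ->
  comp (fun a => iteri (n a) (g a) (f a)).
Proof.
by move=> cn cf cg; apply: bss_app (bss_nat_rec cf cg) (bss_pair (bss_id R A) cn).
Qed.

Lemma bss_foldr A B C (s : A -> seq C) (f : A -> B) (g : A -> C -> B -> B) :
  comp s -> comp f -> comp (fun p : A * C * B => g p.1.1 p.1.2 p.2) ->
  comp (fun a => foldr (g a) (f a) (s a)).
Proof.
by move=> cs cf cg; apply: bss_app (bss_list_rec cf cg) (bss_pair (bss_id R A) cs).
Qed.

Lemma bss_addr A (f g : A -> R) : comp f -> comp g -> comp (fun a => f a + g a).
Proof. by move=> cf cg; apply: bss_app (bss_add R) (bss_pair cf cg). Qed.

Lemma bss_oppr A (f : A -> R) : comp f -> comp (fun a => - f a).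
Proof. exact/bss_app/bss_opp. Qed.

Lemma bss_mulr A (f g : A -> R) : comp f -> comp g -> comp (fun a => f a * g a).
Proof. by move=> cf cg; apply: bss_app (bss_mul R) (bss_pair cf cg). Qed.

Lemma bss_invr A (f : A -> R) : comp f -> comp (fun a => (f a)^-1).
Proof. exact/bss_app/bss_inv. Qed.

Lemma bss_ler A (f g : A -> R) : comp f -> comp g -> comp (fun a => f a <= g a).
Proof. by move=> cf cg; apply: bss_app (bss_le R) (bss_pair cf cg). Qed.

Lemma bss_natr A (n : A -> nat) : comp n -> comp (fun a => (n a)%:R : R).
Proof.
move=> cn; apply: (@bss_ext _ _ (fun a => iteri (n a) (fun _ b => 1 + b) 0)).
  by move=> a; elim: (n a) => //= k ->; rewrite -mulrS.
apply: bss_iteri => //; first exact: bss_real0.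
by apply: bss_addr; [exact: bss_real1|exact: bss_snd].
Qed.

Lemma bss_exprn A (f : A -> R) (n : A -> nat) :
  comp f -> comp n -> comp (fun a => f a ^+ n a).
Proof.
move=> cf cn; apply: (@bss_ext _ _ (fun a => iteri (n a) (fun _ b => f a * b) 1)).
  by move=> a; elim: (n a) => //= k ->; rewrite -exprS.
apply: bss_iteri => //; first exact: bss_real1.
apply: bss_mulr; last exact: bss_snd.
exact/(bss_app cf)/bss_fst_of/bss_fst.
Qed.

Lemma bss_sum A (n : A -> nat) (F : A -> nat -> R) :
  comp n -> comp (fun p : A * nat => F p.1 p.2) ->
  comp (fun a => \sum_(i < n a) F a i).
Proof.
move=> cn cF; apply: (@bss_ext _ _ (fun a => iteri (n a) (fun i b => b + F a i) 0)).
  by move=> a; elim: (n a) => [|k IH] /=; rewrite ?big_ord0 // big_ord_recr IH.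
apply: bss_iteri => //; first exact: bss_real0.
by apply: bss_addr; [exact: bss_snd|exact: bss_app cF (bss_fst _ _ _)].
Qed.

Lemma bss_consr A B (f : A -> B) (s : A -> seq B) :
  comp f -> comp s -> comp (fun a => f a :: s a).
Proof. by move=> cf cs; apply: bss_app (bss_cons R B) (bss_pair cf cs). Qed.

Lemma bss_cat A B (s t : A -> seq B) : comp s -> comp t -> comp (fun a => s a ++ t a).
Proof.
move=> cs ct; apply: (@bss_ext _ _ (fun a => foldr cons (t a) (s a))).
  by move=> a; elim: (s a) => //= b l ->.
apply: bss_foldr => //; apply: bss_consr; last exact: bss_snd.
exact/bss_snd_of/bss_fst.
Qed.

Lemma bss_rcons A B (s : A -> seq B) (f : A -> B) :
  comp s -> comp f -> comp (fun a => rcons (s a) (f a)).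
Proof.
move=> cs cf; apply: (@bss_ext _ _ (fun a => s a ++ [:: f a])).
  by move=> a; rewrite cats1.
by apply: bss_cat => //; apply: bss_consr => //; exact: bss_nil.
Qed.

Lemma bss_rev A B (s : A -> seq B) : comp s -> comp (fun a => rev (s a)).
Proof.
move=> cs; apply: (@bss_ext _ _ (fun a => foldr (fun b t => rcons t b) [::] (s a))).
  by move=> a; elim: (s a) => //= b t ->; rewrite rev_cons.
apply: bss_foldr => //; first exact: bss_nil.
by apply: bss_rcons; [exact: bss_snd|exact/bss_snd_of/bss_fst].
Qed.

Lemma bss_map A B C (s : A -> seq B) (f : A -> B -> C) :
  comp s -> comp (fun p : A * B => f p.1 p.2) -> comp (fun a => map (f a) (s a)).
Proof.
move=> cs cf; apply: (@bss_ext _ _ (fun a => foldr (fun b t => f a b :: t) [::] (s a))).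
  by move=> a; elim: (s a) => //= b t ->.
apply: bss_foldr => //; first exact: bss_nil.
by apply: bss_consr; [exact: bss_app cf (bss_fst _ _ _)|exact: bss_snd].
Qed.

Lemma bss_all A B (s : A -> seq B) (p : A -> B -> bool) :
  comp s -> comp (fun q : A * B => p q.1 q.2) -> comp (fun a => all (p a) (s a)).
Proof.
move=> cs cp; apply: (@bss_ext _ _ (fun a => foldr (fun b c => p a b && c) true (s a))).
  by move=> a; elim: (s a) => //= b t ->.
apply: bss_foldr => //; first exact: bss_bool.
by apply: bss_andb; [exact: bss_app cp (bss_fst _ _ _)|exact: bss_snd].
Qed.

Lemma bss_allpairs A B C D (s : A -> seq B) (t : A -> seq C) (f : A -> B -> C -> D) :
  comp s -> comp t -> comp (fun p : A * B * C => f p.1.1 p.1.2 p.2) ->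
  comp (fun a => [seq f a x y | x <- s a, y <- t a]).
Proof.
move=> cs ct cf.
apply: (@bss_ext _ _ (fun a => foldr (fun x l => [seq f a x y | y <- t a] ++ l) [::] (s a))).
  by move=> a; elim: (s a) => //= b l ->.
apply: bss_foldr => //; first exact: bss_nil.
apply: bss_cat; last exact: bss_snd.
apply: bss_map; first exact/(bss_app ct)/bss_fst_of/bss_fst.
apply: (bss_app (f := fun p : A * B * seq D * C => (p.1.1, p.2)) cf).
apply: bss_pair; last exact: bss_snd.
exact/bss_fst_of/bss_fst.
Qed.

Lemma bss_mkseq A B (n : A -> nat) (F : A -> nat -> B) :
  comp n -> comp (fun p : A * nat => F p.1 p.2) -> comp (fun a => mkseq (F a) (n a)).
Proof.
move=> cn cF; apply: (@bss_ext _ _ (fun a => iteri (n a) (fun i b => rcons b (F a i)) [::])).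
  by move=> a; elim: (n a) => //= k ->; rewrite mkseqS.
apply: bss_iteri => //; first exact: bss_nil.
by apply: bss_rcons; [exact: bss_snd|exact: bss_app cF (bss_fst _ _ _)].
Qed.

Lemma bss_head A B (f : A -> B) (s : A -> seq B) :
  comp f -> comp s -> comp (fun a => head (f a) (s a)).
Proof.
move=> cf cs; apply: (@bss_ext _ _ (fun a => foldr (fun b _ => b) (f a) (s a))).
  by move=> a; case: (s a).
by apply: bss_foldr => //; exact/bss_snd_of/bss_fst.
Qed.

Lemma bss_nilp A B (s : A -> seq B) : comp s -> comp (fun a => nilp (s a)).
Proof.
move=> cs; apply: (@bss_ext _ _ (fun a => foldr (fun _ _ => false) true (s a))).
  by move=> a; case: (s a).
by apply: bss_foldr => //; exact: bss_bool.
Qed.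

(** The fold rebuilds the list together with its tail, in the manner of Kleene's
predecessor. *)
Lemma bss_behead A B (s : A -> seq B) : comp s -> comp (fun a => behead (s a)).
Proof.
move=> cs.
apply: (@bss_ext _ _ (fun a =>
    (foldr (fun b l => (b :: l.1, l.1)) ([::], [::]) (s a)).2)).
  move=> a; suff -> t : foldr (fun (b : B) l => (b :: l.1, l.1)) ([::], [::]) t = (t, behead t) by [].
  by elim: t => //= b t ->.
apply: bss_snd_of; apply: bss_foldr => //.
  by apply: bss_pair; exact: bss_nil.
apply: bss_pair; last exact/bss_fst_of/bss_snd.
by apply: bss_consr; [exact/bss_snd_of/bss_fst|exact/bss_fst_of/bss_snd].
Qed.

Lemma bss_nth A (s : A -> seq R) (n : A -> nat) :
  comp s -> comp n -> comp (fun a => (s a)`_(n a)).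
Proof.
move=> cs cn.
apply: (@bss_ext _ _ (fun a => head 0 (iteri (n a) (fun _ t => behead t) (s a)))).
  move=> a; rewrite -[n a in RHS]addn0 -nth_drop nth0; congr head.
  by elim: (n a) => [|k IH] /=; rewrite ?drop0 // IH -drop1 drop_drop add1n.
apply: bss_head; first exact: bss_real0.
by apply: bss_iteri => //; apply: bss_behead; exact: bss_snd.
Qed.

End BssCombinators.

(** Dispatching on the head symbol, rather than trying the rules in turn, keeps
unification from unfolding the operations. *)
Ltac bss_step :=
  cbv beta;
  lazymatch goal with
  | |- bss_computable _ (fun a => a) => apply: bss_id
  | |- bss_computable _ (fun a => fst (@?f a)) => apply: bss_fst_of
  | |- bss_computable _ (fun a => snd (@?f a)) => apply: bss_snd_of
  | |- bss_computable _ (fun a => pair (@?f a) (@?g a)) => apply: bss_pair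
  | |- bss_computable _ (fun a => andb (@?f a) (@?g a)) => apply: bss_andb
  | |- bss_computable _ (fun a => orb (@?f a) (@?g a)) => apply: bss_orb
  | |- bss_computable _ (fun a => (@?f a + @?g a)%R) => apply: bss_addr
  | |- bss_computable _ (fun a => (- @?f a)%R) => apply: bss_oppr
  | |- bss_computable _ (fun a => (@?f a * @?g a)%R) => apply: bss_mulr
  | |- bss_computable _ (fun a => ((@?f a)^-1)%R) => apply: bss_invr
  | |- bss_computable _ (fun a => (@?f a <= @?g a)%R) => apply: bss_ler
  | |- bss_computable _ (fun a => (@?f a ^+ @?g a)%R) => apply: bss_exprn
  | |- bss_computable _ (fun a => nth _ (@?f a) (@?g a)) => apply: bss_nth
  | |- bss_computable _ (fun a => cat (@?f a) (@?g a)) => apply: bss_cat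
  | |- bss_computable _ (fun a => rev (@?f a)) => apply: bss_rev
  | |- bss_computable _ (fun a => nilp (@?f a)) => apply: bss_nilp
  | |- bss_computable _ (fun a => behead (@?f a)) => apply: bss_behead
  | |- bss_computable _ (fun a => head (@?f a) (@?g a)) => apply: bss_head
  | |- bss_computable _ (fun a => nil) => apply: bss_nil
  | |- bss_computable _ (fun a => cons (@?f a) (@?g a)) => apply: bss_consr
  | |- bss_computable _ (fun a => mkseq _ _) => eapply bss_mkseq
  | |- bss_computable _ (fun a => map _ _) => eapply bss_map
  | |- bss_computable _ (fun a => all _ _) => eapply bss_all
  | |- bss_computable _ (fun a => foldr _ _ _) => eapply bss_foldr
  | |- bss_computable _ (fun a => iteri _ _ _) => eapply bss_iteri
  end.

(** * A computable net of the unit sphere *)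

Section Net.
Variable R : realType.
Implicit Types (d n m : nat) (g u v : seq R) (G N : seq (seq R)) (s a c : R).

(** Points are coordinate lists, read with default value [0]; in particular
[[::]] is the origin. *)
Definition sqdist d u v : R := \sum_(i < d) (u`_i - v`_i) * (u`_i - v`_i).

Definition axis m : seq R :=
  mkseq (fun j => j%:R / m%:R) m.+1 ++ mkseq (fun j => - (j%:R / m%:R)) m.+1.

Definition grid d m : seq (seq R) :=
  iteri d (fun _ b => [seq c :: v | c <- axis m, v <- b]) [:: [::]].

(** The origin takes part in the separation test although it is not put in the
net: it covers no unit vector, and counting it among the separated points saves
one in the bound on the size of the net. *)
Definition greedy d s G : seq (seq R) :=
  foldr (fun g N =>
    if (sqdist d g [::] <= 1) && all (fun v => s ^+ 2 <= sqdist d g v) ([::] :: N)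
    then g :: N else N) [::] G.

Lemma greedy_cons d s g G : greedy d s (g :: G) =
  if (sqdist d g [::] <= 1) &&
     all (fun v => s ^+ 2 <= sqdist d g v) ([::] :: greedy d s G)
  then g :: greedy d s G else greedy d s G.
Proof. by []. Qed.

(* The unreduced application to a pair is the form of the predicate in
   [bss_search]. *)
Lemma natr_ge_ex c : exists n, (fun p : R * nat => p.1 <= p.2%:R) (c, n).
Proof.
exists (Num.bound `|c|); apply: le_trans (ler_norm _) _.
exact/ltW/archi_boundP.
Qed.

Definition natr_ceil c : nat := ex_minn (natr_ge_ex c).

Lemma natr_ceil_ge c : c <= (natr_ceil c)%:R.
Proof. by rewrite /natr_ceil; case: ex_minnP. Qed.

(** The net has to cover the sphere up to [2 / a]. Since its points are taken on
a grid, their separation must be smaller; the slack is chosen so small that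
replacing [1 + a] by [1 + a + net_slack d a] increases the [d]-th power by at
most [1], the one point that the origin saves. *)
Definition net_slack d a : R := (d%:R * (2 + a) ^+ d)^-1.

Definition net_separation d a : R := 2 / (a + net_slack d a).

Definition sphere_net d a : seq (seq R) :=
  greedy d (net_separation d a)
    (grid d (natr_ceil (d%:R / (2 / a - net_separation d a)))).

Lemma dot_point d u v : dot (Defs.point d u - Defs.point d v) (Defs.point d u - Defs.point d v) = sqdist d u v.
Proof. by apply: eq_bigr => i _; rewrite !mxE. Qed.

Lemma point_nil d : Defs.point d [::] = 0 :> 'rV[R]_d.
Proof. by apply/rowP => i; rewrite !mxE nth_nil. Qed.

Lemma greedy_spread d s G : 0 < s ->
  spread s (map (Defs.point d) ([::] :: greedy d s G)) /\
  {in map (Defs.point d) ([::] :: greedy d s G), forall x, enorm x <= 1}.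
Proof.
move=> s0; elim: G => [|g G [[IHu IHs] IH1]].
  split; last by move=> x; rewrite inE => /eqP->; rewrite point_nil enorm0.
  by split=> // x y; rewrite !inE => /eqP-> /eqP->; rewrite eqxx.
rewrite greedy_cons; case: ifP => // /andP[g1 /allP gN].
have far x : x \in map (Defs.point d) ([::] :: greedy d s G) -> s <= enorm (Defs.point d g - x).
  by case/mapP => v vN ->; rewrite le_enorm ?(ltW s0) // dot_point gN.
set N := greedy d s G in IHu IHs IH1 gN far *.
have mem_gN x : (x \in map (Defs.point d) [:: [::], g & N]) =
    (x == Defs.point d g) || (x \in map (Defs.point d) ([::] :: N)).
  by rewrite !inE orbCA.
split; first split.
- have -> : uniq (map (Defs.point d) [:: [::], g & N]) = uniq (Defs.point d g :: map (Defs.point d) ([::] :: N)).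
    by apply/perm_uniq/permP => q /=; rewrite addnCA.
  rewrite cons_uniq IHu andbT; apply/negP => /far.
  by rewrite subrr enorm0 leNgt s0.
- move=> x y; rewrite !mem_gN => /predU1P[->|xN] /predU1P[->|yN].
  + by rewrite eqxx.
  + by move=> _; exact: far.
  + by rewrite enormB => _; exact: far.
  + exact: IHs.
- move=> x; rewrite mem_gN => /predU1P[->|/IH1//].
  by rewrite -[Defs.point d g]subr0 -(point_nil d) enorm_le // dot_point expr1n.
Qed.

Lemma greedy_maximal d s G g : 0 < s -> g \in G -> enorm (Defs.point d g) <= 1 ->
  exists2 v, v \in [::] :: greedy d s G & enorm (Defs.point d g - Defs.point d v) < s.
Proof.
move=> s0 + g1; elim: G => // h G IH; rewrite inE => /predU1P[<-{h}|/IH[v vN vs]].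
  rewrite greedy_cons; case: ifP => [_|/negbT].
    by exists g; rewrite ?inE ?eqxx ?orbT // subrr enorm0.
  rewrite -dot_point point_nil subr0 -[X in _ <= X](expr1n _ 2) -enorm_le // g1 andTb.
  move=> /allPn[v vN]; rewrite -ltNge => vs; exists v => //.
  by rewrite ltNge le_enorm ?(ltW s0) // dot_point -ltNge.
exists v => //; rewrite greedy_cons; case: ifP => // _.
by move: vN; rewrite !inE => /orP[->//|->]; rewrite !orbT.
Qed.

Lemma axis_approx m c : (0 < m)%N -> `|c| <= 1 ->
  exists b, [/\ b \in axis m, `|b| <= `|c| & `|c - b| <= m%:R^-1].
Proof.
move=> m0 c1; have mR0 : 0 < m%:R :> R by rewrite ltr0n.
pose j := Num.truncn (`|c| * m%:R).
have /andP[j1 j2] : j%:R <= `|c| * m%:R < j.+1%:R by apply: truncn_itv; rewrite mulr_ge0.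
have jm : (j < m.+1)%N.
  rewrite ltnS -(ler_nat R); apply: le_trans j1 _.
  by rewrite -[leRHS]mul1r ler_wpM2r.
have j0 : 0 <= j%:R / m%:R :> R by rewrite divr_ge0.
have jc : j%:R / m%:R <= `|c| by rewrite ler_pdivrMr.
have cj : `|c| - j%:R / m%:R <= m%:R^-1.
  rewrite lerBlDr -[X in X + _]mul1r -mulrDl nat1r ler_pdivlMr //; exact: ltW.
have [c0|c0] := leP 0 c.
  have pc : `|c| = c by rewrite ger0_norm.
  rewrite pc in jc cj; exists (j%:R / m%:R); rewrite (ger0_norm j0) pc; split=> //.
    by rewrite mem_cat; apply/orP; left; apply/mapP; exists j; rewrite ?mem_iota.
  by rewrite ger0_norm ?subr_ge0.
have nc : `|c| = - c by rewrite ltr0_norm.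
exists (- (j%:R / m%:R)); rewrite normrN (ger0_norm j0); split=> //.
  by rewrite mem_cat; apply/orP; right; apply/mapP; exists j; rewrite ?mem_iota.
by rewrite ler_norml opprK; rewrite nc in jc cj *; lra.
Qed.

(** Rounding towards the origin keeps the grid point in the unit ball. *)
Lemma grid_approx m u : (0 < m)%N -> (forall i, `|u`_i| <= 1) ->
  exists2 g, g \in grid (size u) m &
    forall i, `|g`_i| <= `|u`_i| /\ `|u`_i - g`_i| <= m%:R^-1.
Proof.
move=> m0; elim: u => [_|c u IH cu1].
  exists [::] => [|i]; first by rewrite inE.
  by rewrite nth_nil subrr normr0 invr_ge0 ler0n.
have [b [bm bc cb]] := axis_approx m0 (cu1 0%N).
have [g gG gu] := IH (fun i => cu1 i.+1).
exists (b :: g); first by apply/allpairsP; exists (b, g).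
by case.
Qed.

Lemma coordsK d (x : 'rV[R]_d) : Defs.point d (coords x) = x.
Proof.
apply/rowP => i; rewrite mxE /coords (nth_map i) ?size_enum_ord //.
by rewrite nth_ord_enum.
Qed.

Lemma size_coords d (x : 'rV[R]_d) : size (coords x) = d.
Proof. by rewrite size_map size_enum_ord. Qed.

Lemma net_slack_itv d a : (0 < d)%N -> 4 < a -> 0 < net_slack d a <= 1.
Proof.
move=> d0 a4; have dR0 : 0 < d%:R :> R by rewrite ltr0n.
have a2 : 1 <= (2 + a) ^+ d by apply: exprn_ege1; lra.
have da0 : 0 < d%:R * (2 + a) ^+ d by rewrite mulr_gt0 //; lra.
rewrite invr_gt0 da0 invf_le1 //=.
by rewrite -[leLHS]mulr1 ler_pM // ler1n.
Qed.

Lemma net_separation_itv d a : (0 < d)%N -> 4 < a -> 0 < net_separation d a < 2 / a.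
Proof.
move=> d0 a4; have /andP[t0 _] := net_slack_itv d0 a4.
rewrite divr_gt0 //=; last by lra.
by rewrite ltr_pM2l // ltf_pV2 ?posrE //; lra.
Qed.

(** Together with the origin the net has at most [(1 + a + net_slack d a) ^+ d]
points, by the packing bound, and this is at most [(1 + a) ^+ d + 1]. *)
Lemma size_sphere_net d a : (0 < d)%N -> 4 < a ->
  (size (sphere_net d a))%:R <= (1 + a) ^+ d.
Proof.
move=> d0 a4; have /andP[t0 t1] := net_slack_itv d0 a4.
have /andP[s0 _] := net_separation_itv d0 a4.
rewrite /sphere_net; set G := grid _ _.
have [sep le1] := greedy_spread d G s0.
have := size_spread_unit_ball s0 sep le1.
rewrite size_map /= -nat1r.
have -> : 2 / net_separation d a = a + net_slack d a.
  by rewrite /net_separation invf_div mulrCA divff ?mulr1.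
move=> h; rewrite -(lerD2l 1); apply: le_trans h _; rewrite -lerBlDr addrA.
rewrite subrXX; have -> : 1 + a + net_slack d a - (1 + a) = net_slack d a by ring.
have slackE : net_slack d a * (d%:R * (2 + a) ^+ d) = 1.
  by rewrite mulVf // -invr_eq0 gt_eqF.
rewrite -[leRHS]slackE ler_pM2l // mulr_natl -[X in _ *+ X](card_ord d) -sumr_const.
apply: ler_sum => i _.
apply: (@le_trans _ _ ((2 + a) ^+ (d.-1 - i) * (2 + a) ^+ i)).
  apply: ler_pM; rewrite ?exprn_ge0 ?lerXn2r ?nnegrE //; lra.
rewrite -exprD; have id := ltn_ord i; apply: ler_weXn2l; first by lra.
by lia.
Qed.

(** The grid point approximating [u] is within the separation of a retained point
or of the origin; the origin is excluded because [2 / a < 1]. *)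
Lemma sphere_net_covers d a (u : 'rV[R]_d) : (0 < d)%N -> 4 < a -> enorm u = 1 ->
  exists2 v, v \in sphere_net d a & enorm (u - Defs.point d v) <= 2 / a.
Proof.
move=> d0 a4 u1; have dR0 : 0 < d%:R :> R by rewrite ltr0n.
have /andP[separation_gt0 separation_lt] := net_separation_itv d0 a4.
rewrite /sphere_net; set s := net_separation d a.
set m := natr_ceil _.
have rs : 0 < 2 / a - s by rewrite subr_gt0.
have md : d%:R / (2 / a - s) <= m%:R by apply: natr_ceil_ge.
have mR0 : 0 < m%:R :> R by apply: lt_le_trans md; rewrite divr_gt0.
have m0 : (0 < m)%N by rewrite -(ltr0n R).
have coord1 i : `|(coords u)`_i| <= 1.
  have [id|id] := ltnP i d; last by rewrite nth_default ?normr0 ?size_coords.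
  by have := coord_le_enorm u (Ordinal id); rewrite u1 -{1}(coordsK u) mxE.
have [g gG gu] := grid_approx m0 coord1; rewrite size_coords in gG.
have uE i : u 0 i = (coords u)`_i by rewrite -{1}(coordsK u) mxE.
have g1 : enorm (Defs.point d g) <= 1.
  rewrite enorm_le // expr1n -[leRHS](expr1n _ 2) -u1 sqr_enorm.
  apply: ler_sum => i _; rewrite mxE uE -!expr2 -[leLHS]real_normK ?num_real //.
  rewrite -[leRHS]real_normK ?num_real // ler_sqr ?nnegrE //.
  by case: (gu i).
have ug : enorm (u - Defs.point d g) <= 2 / a - s.
  apply: (@le_trans _ _ (d%:R * m%:R^-1)).
    by apply: enorm_coord_le => i; rewrite !mxE uE; case: (gu i).
  by rewrite ler_pdivrMr // mulrC -ler_pdivrMr.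
have [v vN gv] := greedy_maximal separation_gt0 gG g1.
have uv : enorm (u - Defs.point d v) <= 2 / a.
  by apply: le_trans (enorm_triangle (Defs.point d g) _ _) _; rewrite -/s in gv; lra.
exists v => //; move: vN; rewrite inE => /predU1P[v0|//].
move: uv; rewrite v0 point_nil subr0 u1 ler_pdivlMr; lra.
Qed.

Lemma bss_natr_ceil A (f : A -> R) :
  bss_computable R f -> bss_computable R (fun x => natr_ceil (f x)).
Proof.
move=> cf; apply: bss_app cf; apply: bss_search.
by apply: bss_ler; [exact: bss_fst|apply: bss_natr; exact: bss_snd].
Qed.

End Net.

(** * The algorithm *)

Section Algorithm.
Variable R : realType.

Definition shift (d : nat) (x : seq R) (delta : R) (u : seq R) : seq R :=
  mkseq (fun i => x`_i + delta * u`_i) d.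

(** A center with its value, and the trial points around it still to be queried.
Since the algorithm stops when no trial point is left, an answer can only meet
an empty list in the initial state; this marks the first queried point as a
center. *)
Definition state : Type := ((seq R * R) * seq (seq R))%type.

Definition update (i : input R) (st : state) (e : seq R * R) : state :=
  let: (d, L, _, _, delta, eps) := i in
  if nilp st.2 || (e.2 <= st.1.2 - delta * (eps / 2))
  then (e, [seq shift d e.1 delta u | u <- sphere_net d (4 * L / eps)])
  else (st.1, behead st.2).

(** The history is in chronological order, and only right folds are computable by
definition: the list is reversed first. *)
Definition replay (i : input R) (h : seq (seq R * R)) : state :=
  foldr (fun e st => update i st e) (([::], 0), [::]) (rev h).

Definition sphere_search : algorithm R := fun p =>
  let st := replay p.1 p.2 in
  if nilp st.2 then (false, st.1.1) else (true, head [::] st.2).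

Lemma replay_rcons i h e : replay i (rcons h e) = update i (replay i h) e.
Proof. by rewrite /replay rev_rcons. Qed.

Lemma bss_sqdist A (d : A -> nat) (u v : A -> seq R) :
  bss_computable R d -> bss_computable R u -> bss_computable R v ->
  bss_computable R (fun p => sqdist (d p) (u p) (v p)).
Proof.
move=> cd cu cv.
apply: (bss_sum (F := fun p i => ((u p)`_i - (v p)`_i) * ((u p)`_i - (v p)`_i))) => //.
have cu1 : bss_computable R (fun p : A * nat => u p.1) by exact/(bss_app cu)/bss_fst.
have cv1 : bss_computable R (fun p : A * nat => v p.1) by exact/(bss_app cv)/bss_fst.
by repeat first [assumption | bss_step | apply: bss_snd].
Qed.

Ltac bss := repeat first
  [ apply: bss_fst | apply: bss_snd | bss_step | apply: bss_real1 | apply: bss_real0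
  | apply: bss_natc | apply: bss_bool | eapply bss_succn | eapply bss_natr
  | eapply bss_natr_ceil | eapply bss_sqdist | eapply bss_if | eapply bss_allpairs ].

Lemma sphere_net_computable :
  bss_computable R (fun p : nat * R => sphere_net p.1 p.2).
Proof. by rewrite /sphere_net /greedy /grid /axis /net_separation /net_slack; bss. Qed.

Lemma bss_sphere_net A (d : A -> nat) (a : A -> R) :
  bss_computable R d -> bss_computable R a ->
  bss_computable R (fun p => sphere_net (d p) (a p)).
Proof. by move=> cd ca; apply: bss_app sphere_net_computable (bss_pair cd ca). Qed.

Lemma update_computable :
  bss_computable R (fun p : input R * state * (seq R * R) => update p.1.1 p.1.2 p.2).
Proof.
apply: (@bss_ext _ _ _ (fun p : input R * state * (seq R * R) =>
  if nilp p.1.2.2 || (p.2.2 <= p.1.2.1.2 - p.1.1.1.2 * (p.1.1.2 / 2))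
  then (p.2, [seq shift p.1.1.1.1.1.1.1 p.2.1 p.1.1.1.2 u |
              u <- sphere_net p.1.1.1.1.1.1.1 (4 * p.1.1.1.1.1.1.2 / p.1.1.2)])
  else (p.1.2.1, behead p.1.2.2))).
  by case=> -[[[[[[d' L'] D] x0] dl] ep] st] e.
rewrite /shift.
repeat first [eapply bss_sphere_net | progress bss].
Qed.

Lemma sphere_search_computable : bss_computable R sphere_search.
Proof.
have cu := update_computable.
have cr : bss_computable R (fun p : input R * seq (seq R * R) => replay p.1 p.2).
  apply: (bss_foldr (g := fun p e st => update p.1 st e)); bss.
  apply: (bss_app (f := fun p : (input R * seq (seq R * R)) * (seq R * R) * state =>
    (p.1.1.1, p.2, p.1.2)) cu); bss.
rewrite /sphere_search; bss; exact: cr.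
Qed.

Lemma point_shift d (x : 'rV[R]_d) (delta : R) (u : seq R) :
  Defs.point d (shift d (coords x) delta u) = x + delta *: Defs.point d u.
Proof.
apply/rowP => i; rewrite !mxE nth_mkseq //; congr (_ + _).
by have := congr1 (fun y : 'rV[R]_d => y 0 i) (coordsK x); rewrite mxE.
Qed.

Section Correctness.
Variables (d : nat) (L Delta delta eps : R) (x0 : 'rV[R]_d) (f : 'rV[R]_d -> R).
Hypotheses (d0 : (0 < d)%N) (delta0 : 0 < delta) (eps0 : 0 < eps) (epsL : eps < L).
Hypothesis f_class : lipschitz_class L Delta x0 f.

Let a := 4 * L / eps.
Let net := sphere_net d a.
Let gain := delta * (eps / 2).
Let i0 : input R := (d, L, Delta, coords x0, delta, eps).
Let s := strategy_of sphere_search L Delta x0 delta eps.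
Let seen (h : history R d) := [seq (coords qv.1, qv.2) | qv <- h].

Let a_gt4 : 4 < a.
Proof. by rewrite /a ltr_pdivlMr // ltr_pM2l. Qed.

(** The invariant of the search: [x] is the center after [k] moves, and the net
directions [tried] have failed around it. Every move has cost at most one pass
over the net and has gained half of [delta * eps]. *)
Definition search_inv (h : history R d) (k : nat) (x : 'rV[R]_d)
    (tried todo : seq (seq R)) : Prop :=
  [/\ net = tried ++ todo,
      replay i0 (seen h) = ((coords x, f x), [seq shift d (coords x) delta u | u <- todo]),
      {in tried, forall u, f x - gain < f (x + delta *: Defs.point d u)},
      (size h <= 1 + k * size net + size tried)%N &
      f x <= f x0 - k%:R * gain].

Lemma search_inv_init : search_inv [:: (x0, f x0)] 0 x0 [::] net.
Proof. by split=> //; rewrite mul0r subr0. Qed.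

Lemma search_inv_step h k x tried u todo (q := x + delta *: Defs.point d u) :
  search_inv h k x tried (u :: todo) ->
  search_inv (rcons h (q, f q)) k x (rcons tried u) todo \/
  search_inv (rcons h (q, f q)) k.+1 q [::] net.
Proof.
move=> [netE stE triedP hk fx].
have st'E : replay i0 (seen (rcons h (q, f q))) =
    update i0 (replay i0 (seen h)) (coords q, f q).
  by rewrite /seen map_rcons replay_rcons.
rewrite stE /= in st'E.
have [better|worse] := leP (f q) (f x - gain).
  right; rewrite better in st'E; split=> //.
    rewrite size_rcons addn0 (leq_ltn_trans hk) // mulSn netE size_cat /=; lia.
  by rewrite -natr1 mulrDl mul1r; lra.
left; rewrite leNgt worse in st'E; split=> //.
- by rewrite cat_rcons.
- by move=> v; rewrite mem_rcons inE => /predU1P[->|/triedP].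
- by rewrite !size_rcons addnS ltnS.
Qed.

Lemma search_inv_count h k x tried todo : search_inv h k x tried todo ->
  k%:R <= 2 * Delta / (delta * eps).
Proof.
move=> [_ _ _ _ fx]; have [_ f_lb f_gap] := f_class.
have : inf (range f) <= f x by apply: ge_inf => //; exists x.
move=> inf_le; rewrite ler_pdivlMr ?mulr_gt0 //.
have kgain : k%:R * gain <= Delta by lra.
have -> : k%:R * (delta * eps) = 2 * (k%:R * gain) by rewrite /gain; field.
by rewrite ler_pM2l.
Qed.

(** Otherwise a unit direction would decrease [f] by [delta * eps]; the net has a
vector within [2 / a = eps / (2 * L)] of it, which by the Lipschitz condition
loses at most half of this decrease, and it would have been accepted. *)
Lemma search_inv_stationary h k x tried : search_inv h k x tried [::] ->
  goldstein_stationary delta eps f x.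
Proof.
move=> [netE _ triedP _ _]; have [f_lip _ _] := f_class.
have L0 : 0 < L by apply: lt_trans epsL.
apply: contrapT => /(goldstein_descent f_lip L0 delta0 eps0) [u u1 fu].
have [v vnet uv] := sphere_net_covers d0 a_gt4 u1.
have := triedP v; rewrite -[tried]cats0 -netE => /(_ vnet).
apply/negP; rewrite -leNgt.
have fuv : f (x + delta *: Defs.point d v) - f (x + delta *: u) <= gain.
  apply: le_trans (ler_norm _) _; apply: le_trans (f_lip _ _) _.
  have -> : x + delta *: Defs.point d v - (x + delta *: u) = delta *: (Defs.point d v - u).
    by rewrite opprD addrACA subrr add0r scalerBr.
  rewrite enormZ (gtr0_norm delta0) enormB.
  have -> : gain = L * (delta * (2 / a)).
    by rewrite /gain /a; field; rewrite !gt_eqF.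
  by rewrite !ler_pM2l.
have gain2 : delta * eps = gain + gain by rewrite /gain; field.
by rewrite gain2 in fu; lra.
Qed.

Lemma search_inv_size h k x tried todo : search_inv h k x tried todo ->
  (size h <= 1 + k.+1 * size net)%N.
Proof.
move=> [netE _ _ hk _]; apply: leq_trans hk _.
by rewrite mulSn netE size_cat; lia.
Qed.

(** The number of moves is at most [2 * Delta / (delta * eps)], so that [B] bounds
the length of all histories and [B - size h] decreases at each query. *)
Lemma search_inv_run h k x tried todo : search_inv h k x tried todo ->
  exists y n, [/\ run f s h y n,
    n%:R <= 1 + (2 * Delta / (delta * eps) + 1) * (1 + a) ^+ d
    & goldstein_stationary delta eps f y].
Proof.
pose B := (1 + (Num.truncn (2 * Delta / (delta * eps))).+1 * size net)%N.
have size_le h' k' x' tried' todo' : search_inv h' k' x' tried' todo' -> (size h' <= B)%N.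
  move=> hp; apply: leq_trans (search_inv_size hp) _.
  rewrite leq_add2l leq_mul2r ltnS; apply/orP; right.
  have kle := search_inv_count hp.
  by rewrite truncn_ge_nat // (le_trans _ kle).
have [n] := ubnP (B - size h); elim: n => // n IH in h k x tried todo *.
rewrite ltnS => Bh hp; have [netE stE _ _ _] := hp.
case: todo hp netE stE => [|u todo] hp netE stE.
  exists x, (size h); split; last exact: search_inv_stationary hp.
    by apply: run_return; rewrite /s /strategy_of /sphere_search /= -/i0 -/(seen h) stE /= coordsK.
  apply: (@le_trans _ _ (1 + k.+1 * size net)%N%:R); first by rewrite ler_nat (search_inv_size hp).
  rewrite natrD lerD2l natrM; apply: ler_pM => //.
    by rewrite -natr1 lerD2r (search_inv_count hp).
  exact: size_sphere_net.
have sh : s h = Query (x + delta *: Defs.point d u).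
  by rewrite /s /strategy_of /sphere_search /= -/i0 -/(seen h) stE /= point_shift.
set q := x + _ in sh.
have [hp'|hp'] := search_inv_step hp; have := size_le _ _ _ _ _ hp';
  rewrite size_rcons => hB; have [|y [m [ym mle yst]]] := IH _ _ _ _ _ _ hp';
  try (by rewrite size_rcons; lia);
  by exists y, m; split => //; apply: run_query ym.
Qed.

End Correctness.
End Algorithm.

Theorem theorem2p3 (R : realType) :
  (exists2 A : algorithm R, bss_computable R A &
     forall (d : nat) (L Delta delta eps : R) (x0 : 'rV[R]_d),
       (1 <= d)%N -> 0 < L -> 0 < Delta -> 0 < delta -> 0 < eps -> eps < L ->
       forall f : 'rV[R]_d -> R, lipschitz_class L Delta x0 f ->
       exists (x : 'rV[R]_d) (n : nat),
         [/\ returns f (strategy_of A L Delta x0 delta eps) x0 x n,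
             n%:R <= 1 + (2 * Delta / (delta * eps) + 1)
                         * (1 + 4 * L / eps) ^+ d
           & goldstein_stationary delta eps f x])
  /\
  (forall (d : nat) (L Delta delta eps : R) (x0 : 'rV[R]_d),
     (1 <= d)%N -> 0 < L -> 0 < Delta -> 0 < delta -> 0 < eps -> L <= eps ->
     forall f : 'rV[R]_d -> R, lipschitz_class L Delta x0 f ->
       goldstein_stationary delta eps f x0
       /\ returns f (fun=> Return x0) x0 x0 1).
Proof.
split.
  exists (@sphere_search R); first exact: sphere_search_computable.
  move=> d L Delta delta eps x0 d1 L0 Delta0 delta0 eps0 epsL f f_class.
  exact: (search_inv_run d1 delta0 eps0 epsL f_class (search_inv_init _ _ _ _ _ _)).
move=> d L Delta delta eps x0 d1 L0 Delta0 delta0 eps0 Leps f [f_lip _ _].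
split; first exact: (lipschitz_goldstein_stationary x0 f_lip L0 delta0 Leps).
exact: (@run_return _ _ _ _ [:: (x0, f x0)]).
Qed.
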